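(* The communication complexity of constructing a $+2$-spanner of an unweighted undirected distributed graph on $n$ vertices with edges observed at $s$ sites in the blackboard model without duplication is $\Omega(s+n^{3/2})$, and the same lower bound $\Omega(s+n^{3/2})$ holds for the communication complexity of constructing a $3$-spanner.
   Context: Distributed graph: there are $s$ sites $S_1,\dots,S_s$; all know the common vertex set $V$, $|V|=n$, and site $S_i$ holds a subset $E_i\subseteq E$ of the edges of an undirected graph $G=(V,E)$, where $E=\bigcup_{i=1}^s E_i$. In the setting without duplication the sets $E_i$ are pairwise disjoint. Blackboard model: sites communicate by writing messages on a shared blackboard (a broadcast channel) visible to all sites and to a coordinator, who must output the result. The communication cost of a protocol is the total number of bits communicated (in the worst case); the communication complexity of a problem is the least communication cost of a (randomized, bounded constant error) protocol solving it. Spanners: a subgraph $H=(V,E')$, $E'\subseteq E$, is a $+2$-spanner of $G$ if $d_H(u,v)\le d_G(u,v)+2$ for all $u,v\in V$, and a $3$-spanner of $G$ if $d_H(u,v)\le 3\,d_G(u,v)$ for all $u,v\in V$, where $d$ denotes shortest-path distance. *)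

(* Defs.v *)
From HB Require Import structures.
From mathcomp Require Import all_boot all_order all_algebra.
From mathcomp Require Import all_classical all_reals all_analysis.

Set Implicit Arguments.
Unset Strict Implicit.
Unset Printing Implicit Defensive.

Import Order.TTheory GRing.Theory Num.Theory.
Local Open Scope classical_set_scope.
Local Open Scope ring_scope.

(** * Graphs on the vertex set ['I_n], distances and spanners *)

Definition edge (n : nat) := {e : {set 'I_n} | #|e| == 2}.

Definition graph (n : nat) := {set edge n}.

Definition adj (n : nat) (G : graph n) : rel 'I_n :=
  fun u v => [exists e in G, val e == [set u; v]%SET].

(** The infimum over the empty set is [+oo], so vertices lying in different
    components are at distance [+oo]; a shortest walk is a shortest path. *)
Definition dist (R : realType) (n : nat) (G : graph n) (u v : 'I_n) : \bar R :=
  ereal_inf [set ((size p)%:R)%:E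
            | p in [set p : seq 'I_n | path (adj G) u p /\ last u p = v]].

Definition additive_spanner (R : realType) (k : nat) (n : nat)
    (G H : graph n) : Prop :=
  H \subset G /\
  forall u v : 'I_n, (dist R H u v <= dist R G u v + (k%:R)%:E)%E.

Definition multiplicative_spanner (R : realType) (t : nat) (n : nat)
    (G H : graph n) : Prop :=
  H \subset G /\
  forall u v : 'I_n, (dist R H u v <= (t%:R)%:E * dist R G u v)%E.

(** * The blackboard model

    [s] sites hold inputs in [X]; the coordinator, who has no input and reads
    only the blackboard, outputs an element of [Y]. *)

(** A deterministic protocol is a binary tree whose nodes are the possible
    blackboard contents.  [Write i f next]: the blackboard content designates
    site [i] as the one to write, and [i] appends the bit [f x], where [x] is
    its own input.  Longer messages are successive nodes owned by one site. *)
Inductive det_protocol (s : nat) (X Y : Type) : Type :=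
| Output of Y
| Write of 'I_s & (X -> bool) & (bool -> det_protocol s X Y).

Fixpoint output (s : nat) (X : finType) (Y : Type)
    (t : det_protocol s X Y) (x : {ffun 'I_s -> X}) : Y :=
  match t with
  | Output y => y
  | Write i f next => output (next (f (x i))) x
  end.

Fixpoint bits (s : nat) (X : finType) (Y : Type)
    (t : det_protocol s X Y) (x : {ffun 'I_s -> X}) : nat :=
  match t with
  | Output _ => 0
  | Write i f next => (bits (next (f (x i))) x).+1
  end.

(** A randomized protocol is a probability distribution over deterministic
    ones, i.e. all parties see the outcome [w] of the coins.  This public-coin
    model subsumes private coins: let the outcomes enumerate a product and the
    bits written by a site depend on its own component only.  The sample space
    is ['I_n_coins] rather than an arbitrary [finType] so as not to raise the
    universe of the record. *)
Record rand_protocol (R : realType) (s : nat) (X Y : Type) := RandProtocol {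
  n_coins : nat ;
  coin_prob : 'I_n_coins -> R ;
  coin_prob_ge0 : forall w, 0 <= coin_prob w ;
  coin_prob_sum1 : \sum_w coin_prob w = 1 ;
  run_with : 'I_n_coins -> det_protocol s X Y
}.

(** Worst case over the coins and over the inputs satisfying the promise. *)
Definition cost (R : realType) (s : nat) (X : finType) (Y : Type)
    (legal : pred {ffun 'I_s -> X}) (A : rand_protocol R s X Y) : nat :=
  \max_(x | legal x) \max_(w < n_coins A) bits (run_with w) x.

Definition solves (R : realType) (s : nat) (X : finType) (Y : Type)
    (delta : R) (legal : pred {ffun 'I_s -> X})
    (correct : {ffun 'I_s -> X} -> Y -> Prop) (A : rand_protocol R s X Y) :
    Prop :=
  forall x, legal x ->
    1 - delta <=
    \sum_(w < n_coins A | `[< correct x (output (run_with w) x) >]) coin_prob w.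

(** The infimum is a minimum, all costs being natural numbers. *)
Definition comm_complexity (R : realType) (s : nat) (X : finType) (Y : Type)
    (delta : R) (legal : pred {ffun 'I_s -> X})
    (correct : {ffun 'I_s -> X} -> Y -> Prop) : \bar R :=
  ereal_inf [set ((cost legal A)%:R)%:E
            | A in [set A : rand_protocol R s X Y |
                    solves delta legal correct A]].

(** * Distributed graphs *)

Definition union_graph (n s : nat) (E : {ffun 'I_s -> graph n}) : graph n :=
  (\bigcup_i E i)%SET.

Definition no_duplication (n s : nat) : pred {ffun 'I_s -> graph n} :=
  fun E => [forall i, forall j, (i != j) ==> [disjoint E i & E j]].

(** Communication complexity, with error probability at most [delta] and
    without duplication, of having the coordinator output some [H] such that
    [spanner G H], where [G] is the union of the sites' graphs. *)
Definition spanner_complexity (R : realType) (delta : R) (n s : nat)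
    (spanner : graph n -> graph n -> Prop) : \bar R :=
  comm_complexity delta (@no_duplication n s)
    (fun E (H : graph n) => spanner (union_graph E) H).

(* Main.v *)
Require Import Defs.
From HB Require Import structures.
From mathcomp Require Import all_boot all_order all_algebra all_field.
From mathcomp Require Import all_classical all_reals all_analysis.
From mathcomp Require Import ring lra zify.

Set Implicit Arguments.
Unset Strict Implicit.
Unset Printing Implicit Defensive.

Import Order.TTheory GRing.Theory Num.Theory.
Local Open Scope ring_scope.

(** Two families of inputs force the two terms.  In a C4-free bipartite graph
    [G0] a detour around an edge has length at least 5, so every subgraph of
    [G0] is its only +2-spanner and its only 3-spanner; if one site holds an
    unknown subgraph of [G0], the coordinator must be able to produce
    [2 ^ #|G0|] different outputs, up to a constant factor, which takes [#|G0|]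
    bits.  The incidence graph of an affine plane over the field with
    [q = 2 ^ k] elements has [2 q^2] vertices and [q^3] edges.  If all sites
    have the empty graph except possibly one, which has [G0], then the
    coordinator must hear from that one with constant probability, so on empty
    inputs a constant fraction of the sites write on average. *)

(** * Lower bounds for blackboard protocols *)

(** At a node the inputs in [S] split by the bit written, and each half continues with one bit less
    of budget; [C] bits thus reach at most [2 ^ C] leaves. *)
Lemma card_outputs (s : nat) (X Y : finType) (t : det_protocol s X Y)
    (S : {set {ffun 'I_s -> X}}) (C : nat) :
  {in S, forall x, (bits t x <= C)%N} ->
  (#|[set output t x | x in S]| <= 2 ^ C)%N.
Proof.
elim: t S C => [y|i f next IH] S C bitsS /=.
  apply: (@leq_trans #|[set y]%SET|); last by rewrite cards1 expn_gt0.
  by apply/subset_leq_card/fintype.subsetP => _ /imsetP[x _ ->]; rewrite inE.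
(* A budget of [0] at a [Write] node is refuted by an actual input in [S], so the empty [S] is
   treated apart. *)
have [->|[x0 x0S]] := set_0Vmem S; first by rewrite imset0 cards0.
case: C bitsS => [/(_ _ x0S)//|C] bitsS.
pose S_ b := [set x in S | f (x i) == b]%SET.
have IHb b : (#|[set output (next b) x | x in S_ b]| <= 2 ^ C)%N.
  by apply: IH => x; rewrite inE => /andP[/bitsS /= + /eqP fx]; rewrite fx.
rewrite expnS mul2n -addnn.
apply: leq_trans (leq_add (IHb true) (IHb false)).
apply: leq_trans (leq_card_setU _ _).
apply/subset_leq_card/fintype.subsetP => _ /imsetP[x xS ->].
rewrite inE; apply/orP.
by case fx: (f (x i)); [left|right]; apply: imset_f; rewrite inE xS fx.
Qed.

Fixpoint writers (s : nat) (X : finType) (Y : Type) (t : det_protocol s X Y)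
    (x : {ffun 'I_s -> X}) : {set 'I_s} :=
  match t with
  | Output _ => finset.set0
  | Write i f next => i |: writers (next (f (x i))) x
  end%SET.

Lemma card_writers (s : nat) (X : finType) (Y : Type)
    (t : det_protocol s X Y) x : (#|writers t x| <= bits t x)%N.
Proof.
elim: t => [y|i f next IH] /=; first by rewrite cards0.
by rewrite cardsU1; case: (_ \notin _); rewrite ?add1n ?ltnS ?add0n // leqW.
Qed.

(** The run consults only the inputs of sites that write, so on [x'] it follows the same branch as
    on [x]. *)
Lemma output_nonwriter (s : nat) (X : finType) (Y : Type)
    (t : det_protocol s X Y) (x x' : {ffun 'I_s -> X}) (i : 'I_s) :
  (forall j, j != i -> x' j = x j) -> i \notin writers t x ->
  output t x' = output t x.
Proof.
move=> xx'; elim: t => [y|j f next IH] //=.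
rewrite !inE negb_or => /andP[ij iw].
by rewrite xx' 1?eq_sym// IH.
Qed.

Lemma bits_cost (R : realType) (s : nat) (X : finType) (Y : Type)
    (legal : pred {ffun 'I_s -> X}) (A : rand_protocol R s X Y)
    (w : 'I_(n_coins A)) x :
  legal x -> (bits (run_with (r := A) w) x <= cost legal A)%N.
Proof.
move=> lx.
apply: leq_trans (leq_bigmax_cond
  (F := fun x => \max_w bits (run_with w) x) x lx).
exact: (leq_bigmax (F := fun w => bits (run_with (r := A) w) x) w).
Qed.

Section RandomizedBounds.
Variables (R : realType) (s : nat) (X Y : finType) (delta : R).
Variables (legal : pred {ffun 'I_s -> X}).
Variable (correct : {ffun 'I_s -> X} -> Y -> Prop).
Variable (A : rand_protocol R s X Y).
Hypothesis A_solves : solves delta legal correct A.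

(** Averaging over the coins: for fixed [w] the protocol is right on at most [2 ^ cost] of the
    inputs [x y], because being right there means producing [y] itself. The pairs [(y, w)] with a
    right answer are counted in both orders. *)
Lemma counting_bound (D : {set Y}) (x : Y -> {ffun 'I_s -> X}) :
  {in D, forall y, legal (x y)} ->
  {in D, forall y z, correct (x y) z -> z = y} ->
  (1 - delta) * #|D|%:R <= 2 ^+ cost legal A.
Proof.
move=> lx cx.
pose good w := [set y in D | output (run_with (r := A) w) (x y) == y]%SET.
have card_good w : (#|good w| <= 2 ^ cost legal A)%N.
  apply: leq_trans (card_outputs (t := run_with (r := A) w)
    (S := [set x y | y in D]%SET) (C := cost legal A) _).
    apply/subset_leq_card/fintype.subsetP => y; rewrite inE => /andP[yD /eqP <-].
    by apply: imset_f; apply: imset_f.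
  by move=> _ /imsetP[y yD ->]; apply: bits_cost; apply: lx.
have -> : (1 - delta) * #|D|%:R = \sum_(y in D) (1 - delta).
  by rewrite sumr_const mulr_natr.
apply: (@le_trans _ _ (\sum_(y in D) \sum_w coin_prob w *+ (y \in good w))).
  apply: ler_sum => y yD; apply: le_trans (A_solves (lx _ yD)) _.
  rewrite big_mkcond; apply: ler_sum => w _.
  rewrite inE yD /=; case: asboolP => [/(cx _ yD) ->|_]; first by rewrite eqxx.
  by rewrite mulrn_wge0// coin_prob_ge0.
rewrite exchange_big /=.
apply: (@le_trans _ _ (\sum_(w < n_coins A) coin_prob w * 2 ^+ cost legal A)).
  apply: ler_sum => w _; rewrite sumrMnr -[leLHS]mulr_natr.
  apply: ler_wpM2l; first exact: coin_prob_ge0.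
  rewrite -natrX ler_nat (leq_trans _ (card_good w))//.
  rewrite -sum1_card big_mkcond [leqRHS]big_mkcond /= leq_sum// => y _.
  by case: ifP => // _; case: (y \in good w).
by rewrite -mulr_suml coin_prob_sum1 mul1r.
Qed.

(** If site [i] is silent on [x0], the outputs on [x0] and [x i] agree, so one of them is wrong. By
    the union bound site [i] writes on [x0] with probability at least [1 - 2 * delta]; summing over
    [i] bounds the expected number of writers, which is at most the cost. *)
Lemma site_bound (x0 : {ffun 'I_s -> X}) (x : 'I_s -> {ffun 'I_s -> X}) :
  legal x0 -> (forall i, legal (x i)) ->
  (forall i j, j != i -> x i j = x0 j) ->
  (forall i z, correct x0 z -> correct (x i) z -> False) ->
  (1 - 2 * delta) * s%:R <= (cost legal A)%:R.
Proof.
move=> l0 lx xE cx.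
pose touched w := writers (run_with (r := A) w) x0.
have site i : 1 - 2 * delta <= \sum_w coin_prob w *+ (i \in touched w).
  have := lerD (A_solves l0) (A_solves (lx i)).
  (* Holds coin by coin: both answers can be right only if [i] is touched. *)
  suff : \sum_(w < n_coins A | `[< correct x0 (output (run_with (r := A) w) x0) >])
            coin_prob w +
         \sum_(w < n_coins A | `[< correct (x i) (output (run_with (r := A) w) (x i)) >])
            coin_prob w <=
         1 + \sum_w coin_prob w *+ (i \in touched w) by lra.
  rewrite -(coin_prob_sum1 A) big_mkcond [X in _ + X <= _]big_mkcond /=.
  rewrite -!big_split /=; apply: ler_sum => w _.
  have p0 := coin_prob_ge0 w.
  case iw: (i \in touched w); rewrite ?mulr1n ?mulr0n.
    by do 2 case: ifP => _; lra.
  rewrite (output_nonwriter (xE i) (negbT iw)).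
  case: asboolP => [c0|_]; case: asboolP => [ci|_]; try lra.
  by case: (cx i _ c0 ci).
have -> : (1 - 2 * delta) * s%:R = \sum_(i < s) (1 - 2 * delta).
  by rewrite sumr_const card_ord mulr_natr.
apply: (@le_trans _ _ (\sum_(i < s) \sum_w coin_prob w *+ (i \in touched w))).
  by apply: ler_sum => i _; exact: site.
rewrite exchange_big /=.
apply: (@le_trans _ _ (\sum_(w < n_coins A) coin_prob w * (cost legal A)%:R)).
  apply: ler_sum => w _; rewrite sumrMnr -[leLHS]mulr_natr.
  apply: ler_wpM2l; first exact: coin_prob_ge0.
  rewrite ler_nat (leq_trans _ (bits_cost w l0))//.
  apply: leq_trans (card_writers _ _).
  by rewrite -sum1_card [leqRHS]big_mkcond /= leq_sum// => i _; case: (_ \in _).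
by rewrite -mulr_suml coin_prob_sum1 mul1r.
Qed.

End RandomizedBounds.

(** * Graphs without short cycles *)

(** This makes the subgraphs of [G0] a family of [2 ^ #|G0|] inputs with forced, pairwise distinct
    outputs. *)
Definition self_spanning (n : nat) (spanner : graph n -> graph n -> Prop)
    (G0 : graph n) : Prop :=
  forall G H : graph n, G \subset G0 -> spanner G H -> H = G.

Lemma adj_sym (n : nat) (G : graph n) (u v : 'I_n) : adj G u v = adj G v u.
Proof. by rewrite /adj finset.setUC. Qed.

Lemma adj_sub (n : nat) (G H : graph n) (u v : 'I_n) :
  H \subset G -> adj H u v -> adj G u v.
Proof.
move=> HG /existsP[e /andP[eH ev]].
by apply/existsP; exists e; rewrite ev (fintype.subsetP HG).
Qed.

Lemma dist_le_walk (R : realType) (n : nat) (G : graph n) (u v : 'I_n)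
    (k : nat) :
  (dist R G u v <= (k%:R)%:E)%E ->
  exists p, [/\ path (adj G) u p, last u p = v & (size p <= k)%N].
Proof.
move=> dk; apply: contrapT => nop.
suff : ((k.+1%:R)%:E <= dist R G u v)%E.
  by move=> /le_trans/(_ dk); rewrite lee_fin ler_nat ltnn.
apply/ereal_infP => _ [p [pp lp] <-].
rewrite lee_fin ler_nat ltnNge; apply/negP => sp.
by apply: nop; exists p.
Qed.

Lemma dist_adj (R : realType) (n : nat) (G : graph n) (u v : 'I_n) :
  adj G u v -> (dist R G u v <= 1%:E)%E.
Proof.
move=> uv; apply: ge_ereal_inf; exists 1%:E => //; exists [:: v] => //=.
by rewrite uv.
Qed.

Section Girth.
Variables (n : nat) (G0 : graph n) (col : 'I_n -> bool).
Hypothesis col_adj : forall u v, adj G0 u v -> col u != col v.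
Hypothesis C4_free : forall u v a b,
  adj G0 u a -> adj G0 u b -> adj G0 v a -> adj G0 v b -> u = v \/ a = b.

(** Lengths 0 and 2 contradict the colouring. A walk of length 3 closes up with the edge to a
    4-cycle, which must degenerate, and then its first or last step is the edge itself. *)
Lemma short_detour (H : graph n) (u : 'I_n) (p : seq 'I_n) :
  H \subset G0 -> adj G0 u (last u p) -> path (adj H) u p ->
  (size p <= 3)%N -> adj H u (last u p).
Proof.
move=> HG; case: p => [|a [|b [|c [|d p]]]] //=.
- by move/col_adj; rewrite eqxx.
- by move=> _ /andP[].
- move=> /col_adj + /and3P[/(adj_sub HG)/col_adj + /(adj_sub HG)/col_adj + _] _.
  by case: (col u) (col a) (col b) => [] [] [].
- move=> uc /and4P[ua ab bc _] _.
  have := C4_free (adj_sub HG ua) uc.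
  move=> /(_ b); rewrite (adj_sym _ b a) => /(_ (adj_sub HG ab) (adj_sub HG bc)).
  by case=> [->|<-].
Qed.

(** Both kinds of spanner put the ends of an edge at distance at most [1 + 2 = 3 * 1], the only
    property of them used here besides inclusion. *)
Lemma self_spanning_girth (R : realType)
    (spanner : graph n -> graph n -> Prop) :
  (forall G H u v, spanner G H -> adj G u v -> (dist R H u v <= 3%:R%:E)%E) ->
  (forall G H, spanner G H -> H \subset G) ->
  self_spanning spanner G0.
Proof.
move=> sp3 spS G H GG0 GH; have HG := spS _ _ GH.
apply/eqP; rewrite finset.eqEsubset HG /=; apply/fintype.subsetP => e eG.
have /cards2P[u [v [uv eE]]] := valP e.
have aG : adj G u v by apply/existsP; exists e; rewrite eG eE eqxx.
have [p [pp lp s3]] := dist_le_walk (sp3 _ _ _ _ GH aG).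
have := short_detour (fintype.subset_trans HG GG0) _ pp s3.
rewrite lp => /(_ (adj_sub GG0 aG)) /existsP[e' /andP[e'H /eqP e'E]].
by have -> : e = e' by apply: val_inj; rewrite eE e'E.
Qed.

Lemma self_spanning_additive (R : realType) :
  self_spanning (@additive_spanner R 2 n) G0.
Proof.
apply: (@self_spanning_girth R) => [G H u v [_ /(_ u v) d] uv|G H []//].
apply: (le_trans d); apply: (le_trans (leeD2r _ (dist_adj R uv))).
by rewrite -EFinD lee_fin; lra.
Qed.

Lemma self_spanning_multiplicative (R : realType) :
  self_spanning (@multiplicative_spanner R 3 n) G0.
Proof.
apply: (@self_spanning_girth R) => [G H u v [_ /(_ u v) d] uv|G H []//].
apply: (le_trans d).
apply: (le_trans (lee_wpmul2l _ (dist_adj R uv))); first by rewrite lee_fin.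
by rewrite -EFinM lee_fin mulr1.
Qed.

End Girth.

Lemma set2_eq (T : finType) (u v x y : T) :
  [set u; v]%SET = [set x; y]%SET -> (u = x /\ v = y) \/ (u = y /\ v = x).
Proof.
move/setP => E; move: (E u) (E v) (E x) (E y).
rewrite !inE !eqxx !orbT /= => /esym/orP[]/eqP-> /esym/orP[]/eqP->; auto.
  by rewrite !orbb => _ /eqP->; left.
by rewrite !orbb => /eqP-> _; left.
Qed.

(** * The point-line incidence graph of an affine plane *)

Lemma affine_lines_meet_once (F : fieldType) (x1 x2 m1 c1 m2 c2 : F) :
  m1 * x1 + c1 = m2 * x1 + c2 -> m1 * x2 + c1 = m2 * x2 + c2 ->
  x1 = x2 \/ (m1, c1) = (m2, c2).
Proof.
move=> e1 e2.
have : (m1 - m2) * (x1 - x2) = 0.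
  have -> : (m1 - m2) * (x1 - x2) =
    (m1 * x1 + c1) - (m2 * x1 + c2) - ((m1 * x2 + c1) - (m2 * x2 + c2)) by ring.
  by rewrite e1 e2 !subrr.
move/eqP; rewrite mulf_eq0 !subr_eq0 => /orP[] /eqP e; last by left.
by right; rewrite e in e1 *; rewrite (addrI _ e1).
Qed.

Section AffinePlane.
Variables (F : finFieldType) (n : nat).
Hypothesis n_large : (2 * #|F| ^ 2 <= n)%N.

(** Left summands are points [(x, y)], right summands are the non-vertical lines [y = m * x + c],
    written [(m, c)]. A flag is given by a line and the abscissa of a point on it, whence [q ^ 3]
    edges. Vertices of ['I_n] outside the image of [T] stay isolated. *)
Let T : finType := ((F * F) + (F * F))%type.

Lemma card_points_lines : (#|T| <= n)%N.
Proof. by rewrite card_sum !card_prod addnn -mul2n mulnn. Qed.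

Let vertex (x : T) : 'I_n := widen_ord card_points_lines (enum_rank x).

Lemma vertex_inj : injective vertex.
Proof. by move=> x y /(congr1 val) /= /val_inj /enum_rank_inj. Qed.

Let flag (t : F * F * F) : {set 'I_n} :=
  let: (m, c, x) := t in
  [set vertex (inl (x, m * x + c)); vertex (inr (m, c))]%SET.

Definition affine_graph : graph n := [set e | [exists t, val e == flag t]]%SET.

Lemma affine_adj u v : adj affine_graph u v ->
  exists m c x,
    (u = vertex (inl (x, m * x + c)) /\ v = vertex (inr (m, c))) \/
    (u = vertex (inr (m, c)) /\ v = vertex (inl (x, m * x + c))).
Proof.
move=> /existsP[e]; rewrite inE => /andP[/existsP[[[m c] x] /eqP ->]].
by move=> /eqP/esym/set2_eq h; exists m, c, x.
Qed.

Lemma affine_bipartite u v : adj affine_graph u v ->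
  (u \in codom (vertex \o inl)) != (v \in codom (vertex \o inl)).
Proof.
have inlT p : vertex (inl p) \in codom (vertex \o inl)
    by apply: (codom_f (vertex \o inl)).
have inrF p : vertex (inr p) \in codom (vertex \o inl) = false.
  by apply/negbTE/negP => /codomP[q] /= /vertex_inj.
by move=> /affine_adj[m [c [x [[-> ->]|[-> ->]]]]]; rewrite inlT inrF.
Qed.

Lemma affine_C4_free u v a b :
  adj affine_graph u a -> adj affine_graph u b ->
  adj affine_graph v a -> adj affine_graph v b -> u = v \/ a = b.
Proof.
move=> /affine_adj[m1 [c1 [x1 ua]]] /affine_adj[m2 [c2 [x2 ub]]].
move=> /affine_adj[m3 [c3 [x3 va]]] /affine_adj[m4 [c4 [x4 vb]]].
(* Mixed cases would identify a point with a line; what remains is [u], [v] both points or both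
   lines. *)
case: ua => -[uE aE]; case: ub => -[]; rewrite uE => /vertex_inj // [e1 e2] bE;
  case: va => -[vE]; rewrite aE => /vertex_inj // [e3 e4];
  case: vb => -[]; rewrite vE bE => /vertex_inj // [e5 e6] /vertex_inj [e7 e8];
  subst.
- by have [->|[-> ->]] := affine_lines_meet_once e2 e6; [left|right].
- by have [->|[-> ->]] := affine_lines_meet_once e4 e8; [right|left].
Qed.

Lemma card_affine_graph : (#|F| ^ 3 <= #|affine_graph|)%N.
Proof.
have flag_inj : injective flag.
  move=> [[m c] x] [[m' c'] x'] /set2_eq[] [] /vertex_inj // [-> _].
  by move=> /vertex_inj [-> ->].
have -> : (#|F| ^ 3 = #|[set flag t | t in [set: F * F * F]]%SET|)%N.
  by rewrite card_imset// cardsT !card_prod !expnS expn0 muln1 mulnA.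
rewrite -(card_imset _ (@val_inj _ _ (edge n))).
apply/subset_leq_card/fintype.subsetP => _ /imsetP[t _ ->].
have flag2 : #|flag t| == 2.
  case: t => [[m c] x]; rewrite cards2 eqSS eqb1.
  by apply/eqP => /vertex_inj.
apply/imsetP; exists (exist _ (flag t) flag2) => //.
by rewrite inE; apply/existsP; exists t.
Qed.

End AffinePlane.

Lemma dense_self_spanning_graph (R : realType) (n : nat) : (2 <= n)%N ->
  exists (G0 : graph n) (q : nat),
  [/\ self_spanning (@additive_spanner R 2 n) G0,
      self_spanning (@multiplicative_spanner R 3 n) G0,
      (0 < q)%N, (n <= (4 * q) ^ 2)%N & (q ^ 3 <= #|G0|)%N].
Proof.
(* For [n < 8] a single edge with [q = 1] suffices, as [n <= 16]. From 8 on, the exponent [k] below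
   is positive, as the existence of the field requires. *)
move=> n2; have [n8|n8] := ltnP n 8.
  pose i0 : 'I_n := Ordinal (ltnW n2); pose i1 : 'I_n := Ordinal n2.
  have i01 : #|[set i0; i1]%SET| == 2 by rewrite cards2.
  pose e : edge n := exist _ [set i0; i1]%SET i01.
  pose G0 : graph n := [set e]%SET.
  have aG u v : adj G0 u v -> (u = i0 /\ v = i1) \/ (u = i1 /\ v = i0).
    by move=> /existsP[_ /andP[/set1P -> /eqP/esym/set2_eq]].
  have col u v : adj G0 u v -> (u == i0) != (v == i0).
    by move=> /aG[] [-> ->].
  have C4 u v a b : adj G0 u a -> adj G0 u b -> adj G0 v a -> adj G0 v b ->
      u = v \/ a = b.
    by move=> /aG[] [-> ->] /aG[] [? ->] _ _; subst; auto.
  exists G0, 1; split=> //.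
  - exact: (self_spanning_additive col C4).
  - exact: (self_spanning_multiplicative col C4).
  - by apply: leq_trans (ltnW n8) _.
  - by rewrite cards1.
have [k k0 /andP[kn nk]] : exists2 k, (0 < k)%N &
    (2 * (2 ^ k) ^ 2 <= n <= (4 * 2 ^ k) ^ 2)%N.
  (* [4 ^ l = q ^ 2] is the largest power of 4 that is at most [n / 2], so [n < 8 * q ^ 2], within
     the required [16 * q ^ 2]. *)
  pose l := trunc_log 4 (n %/ 2).
  have n4 : (4 <= n %/ 2)%N by rewrite leq_divRL.
  exists l; first by rewrite trunc_log_gt0.
  have /andP[l1 l2] := trunc_log_bounds (isT : (1 < 4)%N)
    (leq_trans (isT : (0 < 4)%N) n4).
  have E : ((2 ^ l) ^ 2 = 4 ^ l)%N by rewrite -expnM mulnC expnM.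
  rewrite -/l expnS in l1 l2; rewrite expnMn E.
  move: (4 ^ l)%N l1 l2 {E} => p.
  lia.
have [F _ cF] := pPrimePowerField (isT : prime 2) k0.
have nF : (2 * #|F| ^ 2 <= n)%N by rewrite cF.
have bip := affine_bipartite (n_large := nF).
have C4 := affine_C4_free (n_large := nF).
exists (affine_graph nF), (2 ^ k)%N; split=> //.
- exact: (self_spanning_additive bip C4).
- exact: (self_spanning_multiplicative bip C4).
- by rewrite expn_gt0.
- by rewrite -cF card_affine_graph.
Qed.

(** * Distributed graphs *)

Section Distributed.
Variables (R : realType) (delta : R).
Hypothesis delta_lt2V : delta < 2^-1.
Variables (n s : nat) (spanner : graph n -> graph n -> Prop).

Definition at_site (i : 'I_s) (G : graph n) : {ffun 'I_s -> graph n} :=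
  [ffun j => if j == i then G else finset.set0].

Lemma at_site_no_duplication i G : no_duplication (at_site i G).
Proof.
apply/forallP => j; apply/forallP => k; apply/implyP => jk.
rewrite !ffunE -setI_eq0.
case: (j =P i) => [ji|_]; last by rewrite finset.set0I.
case: (k =P i) => [ki|_]; last by rewrite finset.setI0.
by rewrite ji ki eqxx in jk.
Qed.

Lemma union_at_site i G : union_graph (at_site i G) = G.
Proof.
rewrite /union_graph (bigD1 i)//= ffunE eqxx big1 ?finset.setU0// => j.
by move=> /negbTE ji; rewrite ffunE ji.
Qed.

Variable (G0 : graph n).
Hypothesis G0_self : self_spanning spanner G0.
Variable (A : rand_protocol R s (graph n) (graph n)).
Hypothesis A_solves : solves delta (@no_duplication n s)
  (fun E H => spanner (union_graph E) H) A.

Lemma self_spanning_edges_le_cost (i : 'I_s) :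
  (#|G0| <= cost (@no_duplication n s) A)%N.
Proof.
have : (1 - delta) * #|powerset G0|%:R <= 2 ^+ cost (@no_duplication n s) A.
  apply: (counting_bound A_solves (x := at_site i)) => [G _|G].
    exact: at_site_no_duplication.
  by rewrite powersetE union_at_site => /G0_self; exact.
rewrite card_powerset natrX => C.
(* Since [1 - delta > 1 / 2], the count gives [2 ^ #|G0| < 2 ^ (cost + 1)], so no constant is lost
   in the exponent. *)
rewrite -ltnS -(ltn_exp2l _ _ (isT : (1 < 2)%N)).
rewrite -(ltr_nat R) !natrX exprS.
have a0 : 0 < (2 : R) ^+ #|G0| by rewrite exprn_gt0.
move: (2 ^+ #|G0|) (2 ^+ cost _ _) C a0 => a b C a0.
have : 0 < (2^-1 - delta) * a by rewrite mulr_gt0// subr_gt0.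
lra.
Qed.

(** The all-empty input forces the empty output, while [G0] placed at any one site forces the
    nonempty output [G0]. *)
Lemma sites_le_cost : (0 < #|G0|)%N ->
  (1 - 2 * delta) * s%:R <= (cost (@no_duplication n s) A)%:R.
Proof.
move=> G0_gt0; pose x0 : {ffun 'I_s -> graph n} := [ffun=> finset.set0].
have union_x0 : union_graph x0 = finset.set0.
  by rewrite /union_graph big1// => i _; rewrite ffunE.
apply: (site_bound A_solves (x0 := x0) (x := at_site^~ G0)).
- apply/forallP => j; apply/forallP => k; apply/implyP => _.
  by rewrite !ffunE -setI_eq0 finset.set0I.
- by move=> i; exact: at_site_no_duplication.
- by move=> i j /negbTE ji; rewrite !ffunE ji.
- move=> i H /=; rewrite union_x0 union_at_site.
  move=> /(G0_self (finset.sub0set _)) ->.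
  by move=> /(G0_self (fintype.subxx _)) G0E; rewrite -G0E cards0 in G0_gt0.
Qed.

End Distributed.

Lemma spanner_complexity_ge (R : realType) (delta : R) (n s q : nat)
    (spanner : graph n -> graph n -> Prop) (G0 : graph n) :
  0 < delta -> delta < 2^-1 -> (1 <= s)%N -> self_spanning spanner G0 ->
  (0 < q)%N -> (n <= (4 * q) ^ 2)%N -> (q ^ 3 <= #|G0|)%N ->
  (((1 - 2 * delta) / 128 * (s%:R + n%:R `^ (3 / 2)))%:E <=
   spanner_complexity delta s spanner)%E.
Proof.
move=> d0 d2 s1 G0_self q0 nq qG0.
apply/ereal_infP => _ [A A_solves <-]; rewrite lee_fin.
have G0_gt0 : (0 < #|G0|)%N by apply: leq_trans qG0; rewrite expn_gt0 q0.
have Cs := sites_le_cost G0_self A_solves G0_gt0.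
have CG0 := self_spanning_edges_le_cost d2 G0_self A_solves (Ordinal s1).
(* [n ^ (3 / 2) <= (4 * q) ^ 3 = 64 * q ^ 3], and [q ^ 3] is at most the number of edges of [G0]. *)
have nC : (n%:R : R) `^ (3 / 2) <= 64 * (cost (@no_duplication n s) A)%:R.
  apply: (@le_trans _ _ (((4 * q) ^ 2)%:R `^ (3 / 2))).
    by apply: ge0_ler_powR; rewrite ?nnegrE ?ler0n ?ler_nat//; lra.
  rewrite natrX -powR_mulrn ?ler0n// -powRrM.
  rewrite (_ : 2%:R * (3 / 2) = 3%:R); last by field.
  rewrite powR_mulrn ?ler0n// natrM exprMn -natrX.
  have : ((q ^ 3)%:R : R) <= (cost (@no_duplication n s) A)%:R.
    by rewrite ler_nat (leq_trans qG0).
  lra.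
have p0 : 0 <= (n%:R : R) `^ (3 / 2) by exact: powR_ge0.
(* As [1 - 2 * delta] lies between 0 and 1, the two bounds add up to at most 65 times the cost, and
   [65 <= 128]. *)
nra.
Qed.

Theorem theorem12 (R : realType) (delta : R)
    (delta_gt0 : 0 < delta) (delta_lt2V : delta < 2^-1) :
  (exists c : R, 0 < c /\
     forall n s : nat, (2 <= n)%N -> (1 <= s)%N ->
       ((c * (s%:R + n%:R `^ (3 / 2)))%:E <=
        spanner_complexity delta s (@additive_spanner R 2 n))%E) /\
  (exists c : R, 0 < c /\
     forall n s : nat, (2 <= n)%N -> (1 <= s)%N ->
       ((c * (s%:R + n%:R `^ (3 / 2)))%:E <=
        spanner_complexity delta s (@multiplicative_spanner R 3 n))%E).
Proof.
have c_gt0 : 0 < (1 - 2 * delta) / 128 by lra.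
split; exists ((1 - 2 * delta) / 128); split=> // n s n2 s1;
  have [G0 [q [G0_add G0_mul q0 nq qG0]]] := dense_self_spanning_graph R n2.
- exact: spanner_complexity_ge G0_add q0 nq qG0.
- exact: spanner_complexity_ge G0_mul q0 nq qG0.
Qed.
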